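(* Let $p,k$ be fixed positive integers. There exists $r_0$ such that for every $r\geq r_0$, every $r$-uniform hypergraph $\mathcal H$ with $\Delta_p(\mathcal H)\leq k$ admits a $p$-equitable orientation.
   Context: An $r$-uniform hypergraph $\mathcal H$ is a finite set of $r$-element subsets (edges) of a finite vertex set $V(\mathcal H)$. An orientation of $\mathcal H$ assigns to every edge $S\in\mathcal H$ a bijection $\sigma_S:S\to[r]=\{1,\dots,r\}$ (a total order on its elements). For $U\subseteq V(\mathcal H)$ and $P\subseteq[r]$ with $|U|=|P|$, the degree of $U$ with respect to the set of positions $P$ is $d_P(U)=|\{S\in\mathcal H: U\subseteq S \text{ and } \sigma_S(U)=P\}|$. The orientation is $p$-equitable if $|d_P(U)-d_{P'}(U)|\leq 1$ for every $U\subseteq V(\mathcal H)$ and all $P,P'\subseteq[r]$ with $|U|=|P|=|P'|=p$. Finally, $\Delta_p(\mathcal H)=\max_{U\subseteq V(\mathcal H),\,|U|=p}|\{S\in\mathcal H: U\subseteq S\}|$. *)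

(* Defs.v *)
From mathcomp Require Import all_boot all_order all_algebra.
Set Implicit Arguments. Unset Strict Implicit. Unset Printing Implicit Defensive.

Definition uniform (V : finType) (r : nat) (H : {set {set V}}) : Prop :=
  forall S, S \in H -> #|S| = r.

(* An orientation assigns to every edge S a map sigma S : V -> 'I_r ([r] = {0..r-1})
   whose restriction to S is a bijection S -> 'I_r (for an r-element S this is
   equivalent to injectivity on S). *)
Definition orientation (V : finType) (r : nat) (H : {set {set V}})
  (sigma : {set V} -> V -> 'I_r) : Prop :=
  forall S, S \in H -> {in S &, injective (sigma S)} /\ sigma S @: S = [set: 'I_r].

Definition degP (V : finType) (r : nat) (H : {set {set V}})
  (sigma : {set V} -> V -> 'I_r) (U : {set V}) (P : {set 'I_r}) : nat :=
  #|[set S in H | (U \subset S) && (sigma S @: U == P)]|.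

Definition p_equitable (V : finType) (r p : nat) (H : {set {set V}})
  (sigma : {set V} -> V -> 'I_r) : Prop :=
  forall (U : {set V}) (P P' : {set 'I_r}),
    #|U| = p -> #|P| = p -> #|P'| = p ->
    (`|degP H sigma U P - degP H sigma U P'| <= 1)%N.

Definition Delta (V : finType) (p : nat) (H : {set {set V}}) : nat :=
  \max_(U : {set V} | #|U| == p) #|[set S in H | U \subset S]|.

(* Main.v *)
Require Import Defs.
From mathcomp Require Import all_boot all_order all_algebra.
From mathcomp Require Import perm zify.

(** Orient every edge by an independent uniform random bijection. It suffices that no
    [p]-set [U] receives the same set of positions from two edges containing it: then all
    degrees [d_P(U)] are 0 or 1. Each such collision is a union of events "[sigma S1] and
    [sigma S2] take prescribed values on [U]" of probability about [r ^ - (2 * p)], and the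
    Erdos-Spencer lopsided local lemma applies: two events are dependent only if they share
    an edge together with a vertex or a position in it, which happens for [O(r ^ (2 * p - 1))]
    events only, because [Delta p H <= k]. (The ordinary local lemma, where sharing an edge
    already counts as dependence, would not suffice.) *)

Set Implicit Arguments. Unset Strict Implicit. Unset Printing Implicit Defensive.

(** * Lopsided local lemma by counting *)

Lemma card_bigcup_le (T I : finType) (P : pred I) (F : I -> {set T}) :
  #|\bigcup_(i | P i) F i| <= \sum_(i | P i) #|F i|.
Proof.
elim/big_rec2: _ => [|i m B _ IH]; first by rewrite cards0.
by rewrite (leq_trans (leq_card_setU _ _)) // leq_add2l.
Qed.

Section LopsidedLocalLemma.

Variables (Omega E : finType) (X : {set Omega}) (A : E -> {set Omega}).

Definition avoiding (F : {set E}) : {set Omega} :=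
  [set x in X | [forall e in F, x \notin A e]].

Lemma avoidingP (F : {set E}) (x : Omega) :
  reflect (x \in X /\ forall e, e \in F -> x \notin A e) (x \in avoiding F).
Proof.
rewrite inE; apply: (iffP andP) => -[xX]; last by move=> h; split=> //; apply/forall_inP.
by move/forall_inP.
Qed.

Lemma avoidingS (F G : {set E}) : F \subset G -> avoiding G \subset avoiding F.
Proof.
move=> /subsetP sFG; apply/subsetP => x /avoidingP [xX h].
by apply/avoidingP; split=> // e /sFG; apply: h.
Qed.

Variables (D : {set E}) (nbr : E -> {set E}) (Q : nat).
(** For the uniform measure on [X] this bounds by [1 / Q] the probability of [A e] conditioned on
    avoiding any events outside [nbr e]. An upper bound takes the place of independence. *)
Hypothesis lopsided : forall (e : E) (F : {set E}), e \in D -> F \subset D ->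
  [disjoint F & nbr e] -> Q * #|A e :&: avoiding F| <= #|avoiding F|.
Hypothesis few_nbrs : forall e, e \in D -> 4 * #|nbr e| <= Q.

(** Drop the neighbours of [e] from [F] to get [F1]. The numerator grows and is at most
    [#|avoiding F1| / Q] by [lopsided]. By induction each dropped event has conditional probability
    at most [2 / Q] given [avoiding F1], so with at most [Q / 4] of them [avoiding F] keeps at least
    half of [avoiding F1]. *)
Lemma cond_prob_le (F : {set E}) (e : E) : F \subset D -> e \in D ->
  Q * #|A e :&: avoiding F| <= 2 * #|avoiding F|.
Proof.
have [n] := ubnP #|F|; elim: n F e => // n IHn F e /ltnSE leFn sFD eD.
pose F1 := F :\: nbr e.
have sF1F : F1 \subset F by apply: subsetDl.
have sF1D : F1 \subset D by apply: subset_trans sFD.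
have le1 : Q * #|A e :&: avoiding F1| <= #|avoiding F1|.
  apply: lopsided => //; rewrite -setI_eq0; apply/eqP/setP=> f.
  by rewrite !inE; case: (f \in nbr e); rewrite ?andbF.
have le2 : #|A e :&: avoiding F| <= #|A e :&: avoiding F1|.
  by apply: subset_leq_card; apply: setIS; apply: avoidingS.
have sub : avoiding F1 \subset
    avoiding F :|: \bigcup_(f in F :&: nbr e) (A f :&: avoiding F1).
  apply/subsetP => x xF1; rewrite inE.
  have [//|nxF] := boolP (x \in avoiding F).
  have [xX hF1] := avoidingP _ _ xF1.
  have : ~~ [forall f in F, x \notin A f].
    by apply: contra nxF => /forall_inP h; apply/avoidingP.
  rewrite negb_forall_in => /exists_inP [f fF]; rewrite negbK => xAf.
  apply/bigcupP; exists f; last by rewrite inE xAf.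
  rewrite inE fF /=; apply/negPn/negP => nf.
  by move: (hF1 f); rewrite inE nf fF xAf => /(_ isT).
have le3 : Q * #|\bigcup_(f in F :&: nbr e) (A f :&: avoiding F1)|
    <= #|nbr e| * (2 * #|avoiding F1|).
  apply: leq_trans (_ : \sum_(f in F :&: nbr e) 2 * #|avoiding F1| <= _).
    apply: leq_trans (leq_mul (leqnn Q) (card_bigcup_le _ _)) _.
    rewrite big_distrr /=; apply: leq_sum => f; rewrite inE => /andP [fF fe].
    apply: IHn => //; last by apply: (subsetP sFD).
    (* Induction applies since [f] itself was dropped, making [F1] strictly smaller than [F]. *)
    apply: leq_trans leFn; apply: proper_card; apply/properP; split=> //.
    by exists f; rewrite // inE fe.
  rewrite sum_nat_const leq_mul2r; apply/orP; right.
  by apply: subset_leq_card; apply: subsetIr.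
have le4 := subset_leq_card sub.
have le5 := leq_trans le4 (leq_card_setU _ _).
have [->|Q0] := posnP Q; first by rewrite mul0n.
apply: leq_trans (leq_mul (leqnn Q) le2) _; apply: leq_trans le1 _.
rewrite -(leq_pmul2l Q0).
have := leq_mul (few_nbrs eD) (leqnn #|avoiding F1|).
have := leq_mul (leqnn Q) le5.
rewrite mulnDr; lia.
Qed.

(** Insert the events one at a time: each insertion removes at most a fraction [2 / Q < 1] of the
    points that remain, hence never all of them. *)
Lemma lopsided_local_lemma : 2 < Q -> X != set0 ->
  exists2 x, x \in X & forall e, e \in D -> x \notin A e.
Proof.
move=> Q2 X0.
suff: forall F : {set E}, F \subset D -> avoiding F != set0.
  move=> /(_ D (subxx _)) /set0Pn [x /avoidingP [xX h]]; by exists x.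
move=> F; have [n] := ubnP #|F|; elim: n F => // n IHn F /ltnSE leFn sFD.
have [->|] := eqVneq F set0.
  have [x xX] := set0Pn _ X0.
  by apply/set0Pn; exists x; apply/avoidingP; split=> // e; rewrite inE.
case/set0Pn => e eF.
have eD := subsetP sFD e eF.
have sF1 : F :\ e \subset D by apply: subset_trans (subsetDl _ _) sFD.
have cF : #|F| = #|F :\ e|.+1 by rewrite (cardsD1 e) eF.
have := IHn (F :\ e) ltac:(lia) sF1.
have := cond_prob_le sF1 eD.
have sub : avoiding (F :\ e) \subset avoiding F :|: (A e :&: avoiding (F :\ e)).
  apply/subsetP => x xF1; rewrite in_setU in_setI xF1 andbT.
  have [xX h] := avoidingP _ _ xF1.
  have [_|nxA] := boolP (x \in A e); rewrite ?orbT // orbF.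
  apply/avoidingP; split=> // f fF; have [->//|ne] := eqVneq f e.
  by apply: h; rewrite !inE ne.
have le5 := leq_trans (subset_leq_card sub) (leq_card_setU _ _).
rewrite -!card_gt0; nia.
Qed.

End LopsidedLocalLemma.

(** * Random bijections and switchings *)

Section RandomBijections.

Variables (V : finType) (r : nat).

Notation orient := {ffun {set V} -> {ffun V -> 'I_r}}.
(* The atom [(S, u, i)] stands for the event that [sigma S u = i]. *)
Notation atom := ({set V} * V * 'I_r)%type.

Definition holds (sigma : orient) (t : atom) : bool := sigma t.1.1 t.1.2 == t.2.

(** An atom on an edge conflicts with itself too, so a pairwise conflict-free list has distinct
    vertices and distinct positions on each edge. *)
Definition conflict (t t' : atom) : bool :=
  (t.1.1 == t'.1.1) && ((t.1.2 == t'.1.2) || (t.2 == t'.2)).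

Definition swap (S : {set V}) (i j : 'I_r) (sigma : orient) : orient :=
  [ffun S' => if S' == S then [ffun v => tperm i j (sigma S v)] else sigma S'].

Definition satisfying (T : seq atom) : {set orient} := [set sigma | all (holds sigma) T].

Lemma swapK (S : {set V}) (i j : 'I_r) : involutive (swap S i j).
Proof.
move=> sigma; apply/ffunP => S'; rewrite !ffunE.
case: eqP => [->|//]; apply/ffunP => v.
by rewrite !ffunE eqxx ffunE tpermK.
Qed.

(** Switching: for each position [j] not named in [T], exchange positions [i] and [j] on [S]. The
    result determines [j], as the new value at [u], and then [sigma], because [swap] is an
    involution. At least [r - size T] positions are available. *)
Lemma card_satisfying_cons (t : atom) (T : seq atom) (Y : {set orient}) :
  (forall t', t' \in T -> ~~ conflict t t') ->
  (forall sigma j, sigma \in Y -> holds sigma t -> swap t.1.1 t.2 j sigma \in Y) ->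
  (r - size T) * #|satisfying (t :: T) :&: Y| <= #|satisfying T :&: Y|.
Proof.
case: t => -[S u] i /= ncT swY.
pose G := [set j : 'I_r | j \notin [seq t.2 | t <- T]].
have cG : r - size T <= #|G|.
  have := cardsC G; rewrite card_ord.
  have : #|~: G| <= size T.
    rewrite -(size_map snd); apply: leq_trans (card_size _).
    by apply: subset_leq_card; apply/subsetP => j; rewrite !inE negbK.
  lia.
apply: leq_trans (leq_mul cG (leqnn _)) _.
pose Z := satisfying ((S, u, i) :: T) :&: Y.
rewrite -/Z -cardsX.
pose h (x : 'I_r * orient) := swap S i x.1 x.2.
have hSu x : x \in setX G Z -> h x S u = x.1.
  case: x => j sigma; rewrite !inE /= => /and3P [_ /andP [/eqP /= su _] _].
  by rewrite /h /swap !ffunE eqxx ffunE su tpermL.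
have injh : {in setX G Z &, injective h}.
  move=> [j sigma] [j' sigma'] xZ x'Z eqh.
  have jj : j = j' by have := hSu _ xZ; rewrite eqh (hSu _ x'Z).
  congr (_, _) => //.
  by move: eqh; rewrite /h /= jj => /(can_inj (swapK _ _ _)).
rewrite -(card_in_imset injh); apply: subset_leq_card; apply/subsetP => tau.
case/imsetP => -[j sigma]; rewrite !inE /= => /and3P [jG /andP [st sT] sY] ->.
(* An atom of [T] on the edge [S] survives: its position differs from [i] by absence of conflict and
   from [j] by the choice of [G]. *)
rewrite /h swY // andbT; apply/allP => -[[S' u'] i'] tT.
have := allP sT _ tT; rewrite /holds /= => /eqP si.
rewrite /swap ffunE; have [eS|_] := eqVneq S' S; last by rewrite si.
rewrite ffunE -eS si; have := ncT _ tT.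
rewrite /conflict /= eS eqxx /= negb_or => /andP [_ ne].
rewrite tpermD //; apply: contraNneq jG => ->.
by apply/mapP; exists (S', u', i').
Qed.

(** Peel off the atoms one by one, each gaining a factor of at least [r - m]. With [Y] the
    bijections avoiding non-conflicting events, this becomes the lopsided condition. *)
Lemma card_satisfying (m : nat) (T : seq atom) (Y : {set orient}) :
  size T <= m ->
  pairwise (fun t t' => ~~ conflict t t') T ->
  (forall t, t \in T ->
    forall sigma j, sigma \in Y -> holds sigma t -> swap t.1.1 t.2 j sigma \in Y) ->
  (r - m) ^ size T * #|satisfying T :&: Y| <= #|Y|.
Proof.
elim: T => [|t T IHT] /= leTm.
  by rewrite mul1n => _ _; apply: subset_leq_card; apply: subsetIr.
move=> /andP [/allP nct ncT] swY.
have leT := card_satisfying_cons nct (swY t (mem_head _ _)).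
have := IHT (ltnW leTm) ncT (fun t' t'T => swY t' (mem_behead (s := t :: T) t'T)).
apply: leq_trans; rewrite expnS mulnAC mulnC leq_mul2l; apply/orP; right.
by apply: leq_trans leT; rewrite leq_mul2r; apply/orP; right; lia.
Qed.

Variable H : {set {set V}}.

(** Values off the edges stay free, and surjectivity on edges comes later from uniformity. *)
Definition bijections : {set orient} := [set sigma : orient |
  [forall S in H, forall u in S, forall v in S, (sigma S u == sigma S v) ==> (u == v)]].

Lemma bijectionsP (sigma : orient) :
  reflect (forall S, S \in H -> {in S &, injective (sigma S)}) (sigma \in bijections).
Proof.
rewrite inE; apply: (iffP idP) => [h S SH u v uS vS|h].
  move/eqP => suv; have /forall_inP /(_ S SH) /forall_inP /(_ u uS) := h.
  by move/forall_inP/(_ v vS); rewrite suv => /eqP.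
apply/forall_inP => S SH; apply/forall_inP => u uS; apply/forall_inP => v vS.
by apply/implyP => /eqP /(h S SH u v uS vS) ->.
Qed.

Lemma swap_bijections (S : {set V}) (i j : 'I_r) (sigma : orient) :
  sigma \in bijections -> swap S i j sigma \in bijections.
Proof.
move=> /bijectionsP bs; apply/bijectionsP => S' S'H u v uS vS.
rewrite /swap !ffunE; case: eqP => [eS|_]; last exact: bs.
by subst S'; rewrite !ffunE => /perm_inj; apply: bs.
Qed.

Variables (E : finType) (D : {set E}) (atoms : E -> seq atom) (m : nat).

Definition conflicting (e : E) : {set E} :=
  [set f in D | has (fun t => has (conflict t) (atoms f)) (atoms e)].

Hypothesis atoms_wf : forall e t, e \in D -> t \in atoms e -> t.1.1 \in H /\ t.1.2 \in t.1.1.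
Hypothesis size_atoms : forall e, e \in D -> size (atoms e) = m.
Hypothesis atoms_compatible : forall e, e \in D ->
  pairwise (fun t t' => ~~ conflict t t') (atoms e).
Hypothesis few_conflicts : forall e, e \in D -> 4 * #|conflicting e| <= (r - m) ^ m.

Notation event := (fun e => satisfying (atoms e)).

(* Swapping the positions [i] and [j] in [S] creates no atom in [S] that avoids both
   [u] and [i] when [sigma S u = i]. *)
Lemma swap_avoiding (F : {set E}) (t : atom) (j : 'I_r) (sigma : orient) :
  F \subset D -> t.1.1 \in H -> t.1.2 \in t.1.1 ->
  (forall f t', f \in F -> t' \in atoms f -> ~~ conflict t t') ->
  sigma \in avoiding bijections event F -> holds sigma t ->
  swap t.1.1 t.2 j sigma \in avoiding bijections event F.
Proof.
case: t => -[S u] i /= sFD SH uS nc /avoidingP [bs av] /eqP /= su.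
apply/avoidingP; split; first exact: swap_bijections.
move=> f fF; apply: contra (av f fF); rewrite !inE => /allP sw.
apply/allP => -[[S' v] l] tf; have := sw _ tf; rewrite /holds /= /swap ffunE.
have [eS|//] := eqVneq S' S; subst S'; rewrite ffunE => /eqP sv.
have := nc _ _ fF tf; rewrite /conflict /= eqxx /= negb_or => /andP [nuv nil].
have vS : v \in S by have [] := atoms_wf (subsetP sFD _ fF) tf.
have {}sv : sigma S v = tperm i j l by rewrite -sv tpermK.
(* If [l] is not [j], the atom held already before the swap. If it is [j], then [v] had position
   [i], the position of [u], so [v = u] against the absence of conflict. *)
rewrite sv; have [ejl|njl] := eqVneq j l; last by rewrite tpermD.
move: sv; rewrite ejl tpermR -su => /(bijectionsP _ bs S SH v u vS uS) vu.
by rewrite vu eqxx in nuv.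
Qed.

Lemma bijections_local_lemma : 2 < (r - m) ^ m -> bijections != set0 ->
  exists2 sigma, sigma \in bijections & forall e, e \in D -> sigma \notin event e.
Proof.
apply: (lopsided_local_lemma (nbr := conflicting)) => // e F eD sFD disF.
(* Here [Q] is [(r - m) ^ m]; only its exponent is rewritten. *)
rewrite -{2}(size_atoms eD).
apply: card_satisfying; [by rewrite size_atoms|exact: atoms_compatible|].
move=> t te sigma j; have [SH uS] := atoms_wf eD te.
apply: swap_avoiding => // f t' fF t'f; apply/negP => ctt'.
have := disjointFr disF fF; rewrite inE (subsetP sFD _ fF) /=.
by case/hasP; exists t => //; apply/hasP; exists t'.
Qed.

End RandomBijections.

(** * Counting functions with a prescribed value *)

Lemma card_ffuns_into (I T : finType) (B : {set T}) :
  #|[set f : {ffun I -> T} | [forall x, f x \in B]]| = #|B| ^ #|I|.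
Proof.
rewrite -(card_ffun_on I (mem B)); apply: eq_card => f; rewrite inE.
by apply/forallP/ffun_onP.
Qed.

(** Prescribing one value saves one factor [#|B|]; this is the source of the exponent [2 * p - 1] in
    the count of conflicts. *)
Lemma card_pinned_ffuns_into (I T : finType) (B : {set T}) (j : I) (a : T) :
  #|[set f : {ffun I -> T} | (f j == a) && [forall x, f x \in B]]| <= #|B| ^ #|I|.-1.
Proof.
pose F x : pred T := if x == j then pred1 a else mem B.
apply: leq_trans (_ : #|family F| <= _).
  apply: subset_leq_card; apply/subsetP => f; rewrite !inE => /andP [/eqP fj /forallP fB].
  by apply/familyP => x; rewrite /F; case: eqP => [->|_]; rewrite ?inE ?fj //; apply: fB.
rewrite card_family foldrE big_map big_enum /= (bigD1 j) //= /F eqxx card1 mul1n.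
rewrite (eq_bigr (fun=> #|B|)); last by move=> x /negbTE ->.
by rewrite prod_nat_const cardC1.
Qed.

(** * Collision events and their conflicts *)

Section Collisions.

Variables (V : finType) (r p k : nat) (H : {set {set V}}).
Hypotheses (unifH : uniform r H) (degH : Delta p H <= k).

(* [(S1, S2, w, l, s)] encodes the event that [sigma S1] maps each [w j] to [l j] and
   [sigma S2] maps each [w j] to [l (s j)]; its probability is of order [r ^ - (2 * p)]. *)
Notation param := ({set V} * {set V} * {ffun 'I_p -> V} * {ffun 'I_p -> 'I_r}
  * {ffun 'I_p -> 'I_p})%type.
Notation atom := ({set V} * V * 'I_r)%type.

Definition collision_atoms (e : param) : seq atom :=
  let: (S1, S2, w, l, s) := e in
  [seq (S1, w j, l j) | j <- enum 'I_p] ++ [seq (S2, w j, l (s j)) | j <- enum 'I_p].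

Definition collisions : {set param} := [set e : param |
  let: (S1, S2, w, l, s) := e in
  [&& S1 \in H, S2 \in H, S1 != S2, injectiveb w, injectiveb l, injectiveb s
    & [forall j, w j \in S1 :&: S2]]].

Lemma collisionsP (S1 S2 : {set V}) (w : {ffun 'I_p -> V}) (l : {ffun 'I_p -> 'I_r})
    (s : {ffun 'I_p -> 'I_p}) :
  reflect [/\ S1 \in H /\ S2 \in H, S1 != S2, [/\ injective w, injective l & injective s]
             & forall j, (w j \in S1) /\ (w j \in S2)]
          ((S1, S2, w, l, s) \in collisions).
Proof.
rewrite inE; apply: (iffP idP).
  case/and5P => S1H S2H ne /injectiveP iw /and3P [/injectiveP il /injectiveP iS /forallP ws].
  by split=> // j; have := ws j; rewrite inE => /andP.
case=> -[S1H S2H] ne [/injectiveP iw /injectiveP il /injectiveP iS] ws.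
by apply/and5P; split=> //; apply/and3P; split=> //; apply/forallP => j; rewrite inE; apply/andP.
Qed.

Lemma size_collision_atoms (e : param) : size (collision_atoms e) = 2 * p.
Proof.
case: e => -[[[S1 S2] w] l] s.
by rewrite size_cat 2!size_map -cardE card_ord mul2n addnn.
Qed.

Lemma collision_atoms_wf (e : param) (t : atom) :
  e \in collisions -> t \in collision_atoms e -> t.1.1 \in H /\ t.1.2 \in t.1.1.
Proof.
case: e => -[[[S1 S2] w] l] s /collisionsP [[S1H S2H] _ _ ws].
by rewrite mem_cat => /orP [] /mapP [j _ ->] /=; have [] := ws j.
Qed.

Lemma collision_atoms_compatible (e : param) : e \in collisions ->
  pairwise (fun t t' => ~~ conflict t t') (collision_atoms e).
Proof.
case: e => -[[[S1 S2] w] l] s /collisionsP [_ ne [iw il iS] _].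
rewrite pairwise_cat; apply/and3P; split.
- apply/allrelP => t t' /mapP [j _ ->] /mapP [j' _ ->].
  by rewrite /conflict /= (negbTE ne).
- have := enum_uniq 'I_p; rewrite pairwise_map uniq_pairwise; apply: sub_pairwise => j j' /= njj.
  by rewrite /conflict /= eqxx /= !inj_eq // orbb.
- have := enum_uniq 'I_p; rewrite pairwise_map uniq_pairwise; apply: sub_pairwise => j j' /= njj.
  by rewrite /conflict /= eqxx /= !inj_eq // orbb.
Qed.

Lemma card_edges_containing (w : {ffun 'I_p -> V}) : injective w ->
  #|[set S in H | [forall j, w j \in S]]| <= k.
Proof.
move=> iw; apply: leq_trans degH.
have cw : #|w @: [set: 'I_p]| == p by rewrite card_imset // cardsT card_ord.
apply: leq_trans (leq_bigmax_cond _ cw); apply: subset_leq_card; apply/subsetP => S.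
rewrite !inE => /andP [-> /forallP wS] /=; apply/subsetP => v /imsetP [j _ ->].
exact: wS.
Qed.

(** Choose [d.2] first: its image is a [p]-set, so at most [k] edges contain it. *)
Lemma card_edge_embeddings (W : {set {ffun 'I_p -> V}}) :
  #|[set d : {set V} * {ffun 'I_p -> V} |
      [&& d.1 \in H, d.2 \in W, injectiveb d.2 & [forall j, d.2 j \in d.1]]]| <= #|W| * k.
Proof.
pose B (w : {ffun 'I_p -> V}) := [set S in H | [forall j, w j \in S]].
apply: leq_trans (_ : #|\bigcup_(w in W | injectiveb w) [set (S, w) | S in B w]| <= _).
  apply: subset_leq_card; apply/subsetP => -[S w].
  rewrite inE /= => /and4P [SH wW iw wS]; apply/bigcupP; exists w; first by rewrite wW.
  by apply/imsetP; exists S; rewrite ?inE ?SH.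
apply: leq_trans (card_bigcup_le _ _) _.
apply: leq_trans (_ : \sum_(w in W | injectiveb w) k <= _).
  apply: leq_sum => w /andP [_ /injectiveP iw].
  by apply: leq_trans (leq_imset_card _ _) _; apply: card_edges_containing.
rewrite sum_nat_const leq_mul2r; apply/orP; right.
by apply: subset_leq_card; apply/subsetP => w /andP [].
Qed.

Definition collisions_at (b : bool) (S : {set V}) (W : {set {ffun 'I_p -> V}})
    (L : {set {ffun 'I_p -> 'I_r}}) : {set param} := [set e in collisions |
  let: (S1, S2, w, l, s) := e in
  [&& (if b then S1 else S2) == S, w \in W & l \in L]].

(** Once [S] is one of the two edges, it remains to choose [w], the other edge through its image,
    [l] and [s]; all [p ^ p] maps are allowed for [s]. *)
Lemma card_collisions_at (b : bool) (S : {set V}) (W : {set {ffun 'I_p -> V}})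
    (L : {set {ffun 'I_p -> 'I_r}}) :
  #|collisions_at b S W L| <= #|W| * k * #|L| * p ^ p.
Proof.
pose C := [set d : {set V} * {ffun 'I_p -> V} |
  [&& d.1 \in H, d.2 \in W, injectiveb d.2 & [forall j, d.2 j \in d.1]]].
pose g (x : {set V} * {ffun 'I_p -> V} * {ffun 'I_p -> 'I_r} * {ffun 'I_p -> 'I_p}) : param :=
  let: (d, l, s) := x in
  if b then (S, d.1, d.2, l, s) else (d.1, S, d.2, l, s).
apply: leq_trans (_ : #|g @: setX (setX C L) setT| <= _).
  apply: subset_leq_card; apply/subsetP => -[[[[S1 S2] w] l] s].
  rewrite inE => /andP [/collisionsP [[S1H S2H] ne [iw il iS] ws] /and3P [/eqP eS wW lL]].
  apply/imsetP; exists ((if b then S2 else S1, w), l, s).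
    apply/setXP; split; last exact: in_setT.
    apply/setXP; split=> //; rewrite inE /=; apply/and4P; split=> //; first by case: (b).
      exact/injectiveP.
    by apply/forallP => j; have [] := ws j; case: (b).
  by rewrite /g; move: eS; case: (b) => /= ->.
apply: leq_trans (leq_imset_card _ _) _.
rewrite !cardsX cardsT card_ffun !card_ord !leq_mul2r.
by rewrite card_edge_embeddings !orbT.
Qed.

(** A conflict puts [S] among the two edges and prescribes one value of [w] or of [l], leaving
    [r ^ p.-1] choices for that map and [r ^ p] for the other. The factor [4 * p] counts the index,
    which edge is [S], and whether a vertex or a position is shared. *)
Lemma card_conflicting_atom (t : atom) : t.1.1 \in H ->
  #|[set f in collisions | has (conflict t) (collision_atoms f)]|
    <= 4 * p * (k * p ^ p * r ^ (2 * p).-1).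
Proof.
case: t => -[S u] i /= SH; have cS := unifH SH.
pose W (j : 'I_p) := [set w : {ffun 'I_p -> V} | (w j == u) && [forall x, w x \in S]].
pose W0 := [set w : {ffun 'I_p -> V} | [forall x, w x \in S]].
pose L (j : 'I_p) := [set l : {ffun 'I_p -> 'I_r} |
  (l j == i) && [forall x, l x \in [set: 'I_r]]].
pose G (x : 'I_p * bool * bool) := let: (j, b, c) := x in
  if c then collisions_at b S (W j) setT else collisions_at b S W0 (L j).
apply: leq_trans (_ : #|\bigcup_x G x| <= _).
  apply: subset_leq_card; apply/subsetP => -[[[[S1 S2] w] l] s].
  rewrite inE => /andP [fC /hasP [t' t'f ct]].
  have [[S1H S2H] ne [iw il iS] ws] := collisionsP _ _ _ _ _ fC.
  have lT : [forall x, l x \in [set: 'I_r]] by apply/forallP.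
  move: t'f; rewrite mem_cat => /orP [] /mapP [j _ et'].
    move: ct; rewrite et' /conflict /= => /andP [/eqP eS].
    have wS : [forall x, w x \in S] by apply/forallP => x; rewrite eS; have [] := ws x.
    case/orP => /eqP ex; apply/bigcupP.
      by exists (j, true, true); rewrite // inE fC !inE -eS -ex wS !eqxx.
    by exists (j, true, false); rewrite // inE fC !inE -eS -ex wS lT !eqxx.
  move: ct; rewrite et' /conflict /= => /andP [/eqP eS].
  have wS : [forall x, w x \in S] by apply/forallP => x; rewrite eS; have [] := ws x.
  case/orP => /eqP ex; apply/bigcupP.
    by exists (j, false, true); rewrite // inE fC !inE -eS -ex wS !eqxx.
  (* On the second edge [w j] has position [l (s j)], so the prescribed value of [l] is at [s j]. *)
  by exists (s j, false, false); rewrite // inE fC !inE -eS -ex wS lT !eqxx.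
apply: leq_trans (card_bigcup_le _ _) _.
apply: leq_trans (_ : \sum_(x : 'I_p * bool * bool) k * p ^ p * r ^ (2 * p).-1 <= _); last first.
  by rewrite sum_nat_const !card_prod card_ord card_bool leq_mul2r; apply/orP; right; lia.
apply: leq_sum => -[[j b] c] _ /=.
(* The index [j] itself witnesses that [p] is positive. *)
have p0 : 0 < p by apply: leq_ltn_trans (ltn_ord j).
have er : r ^ (2 * p).-1 = r ^ p.-1 * r ^ p by rewrite -expnD; congr (_ ^ _); lia.
case: c; apply: leq_trans (card_collisions_at _ _ _ _) _.
  have := card_pinned_ffuns_into S j u; rewrite cS card_ord => cW.
  rewrite cardsT card_ffun !card_ord er.
  have -> : k * p ^ p * (r ^ p.-1 * r ^ p) = r ^ p.-1 * k * r ^ p * p ^ p by lia.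
  by rewrite !leq_mul2r cW !orbT.
have := card_pinned_ffuns_into [set: 'I_r] j i; rewrite cardsT !card_ord => cL.
have := card_ffuns_into 'I_p S; rewrite cS card_ord => cW.
rewrite cW er.
have -> : k * p ^ p * (r ^ p.-1 * r ^ p) = r ^ p * k * r ^ p.-1 * p ^ p by lia.
by rewrite leq_mul2r leq_mul2l cL !orbT.
Qed.

Lemma card_conflicting_collisions (e : param) : e \in collisions ->
  #|conflicting collisions collision_atoms e|
    <= 8 * p ^ 2 * (k * p ^ p * r ^ (2 * p).-1).
Proof.
move=> eC; set B := k * _ * _.
pose N t := [set f in collisions | has (conflict t) (collision_atoms f)].
apply: leq_trans (_ : #|\bigcup_(t in [set t in collision_atoms e]) N t| <= _).
  apply: subset_leq_card; apply/subsetP => f; rewrite inE => /andP [fC /hasP [t te ct]].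
  by apply/bigcupP; exists t; rewrite in_set // fC.
apply: leq_trans (card_bigcup_le _ _) _.
apply: leq_trans (_ : \sum_(t in [set t in collision_atoms e]) 4 * p * B <= _).
  apply: leq_sum => t; rewrite inE => te; apply: card_conflicting_atom.
  by have [] := collision_atoms_wf eC te.
rewrite sum_nat_const.
have : #|[set t in collision_atoms e]| <= 2 * p.
  by rewrite cardsE -(size_collision_atoms e) card_size.
rewrite -mulnn; nia.
Qed.

Lemma bijections_neq0 : 0 < r -> bijections r H != set0.
Proof.
case: r unifH => // r' uH _; apply/set0Pn.
(* Number each edge along its enumeration; on an edge the indices of its elements are below [r], so
   [inord] does not fall back to its default there. *)
exists [ffun S : {set V} => [ffun v => inord (index v (enum S))]].
apply/bijectionsP => S SH u v uS vS; rewrite !ffunE => /(congr1 val) /=.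
have lt x : x \in S -> index x (enum S) < r'.+1.
  by move=> xS; rewrite -(uH _ SH) cardE index_mem mem_enum.
rewrite !inordK ?lt // => /(congr1 (nth u (enum S))).
by rewrite !nth_index ?mem_enum.
Qed.

Lemma bijections_orientation (sigma : {ffun {set V} -> {ffun V -> 'I_r}}) :
  sigma \in bijections r H -> orientation H (fun S => sigma S).
Proof.
move=> /bijectionsP bs S SH; split; first exact: bs.
apply/eqP; rewrite eqEcard subsetT cardsT card_ord card_in_imset; last exact: bs.
by rewrite (unifH SH) leqnn.
Qed.

(** Two edges counted by the degree give a collision: [w] enumerates [U], [l] records its positions
    in [S1], and [s] matches them with those in [S2], which form the same set [P]. *)
Lemma degP_le1 (sigma : {ffun {set V} -> {ffun V -> 'I_r}}) (U : {set V}) (P : {set 'I_r}) :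
  sigma \in bijections r H ->
  (forall e, e \in collisions -> sigma \notin satisfying (collision_atoms e)) ->
  #|U| = p -> degP H (fun S => sigma S) U P <= 1.
Proof.
move=> /bijectionsP bs av cU; rewrite leqNgt; apply/negP => /card_gt1P [S1 [S2 []]].
rewrite !inE => /and3P [S1H US1 /eqP eP1] /and3P [S2H US2 /eqP eP2] ne.
pose w : {ffun 'I_p -> V} := [ffun j => enum_val (cast_ord (esym cU) j)].
have wU j : w j \in U by rewrite ffunE enum_valP.
have iw : injective w.
  by move=> j j'; rewrite !ffunE => /enum_val_inj /cast_ord_inj.
pose l : {ffun 'I_p -> 'I_r} := [ffun j => sigma S1 (w j)].
have exs j : exists j', sigma S2 (w j) == l j'.
  have : sigma S2 (w j) \in [set sigma S1 x | x in U].
    by rewrite eP1 -eP2; apply/imsetP; exists (w j).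
  case/imsetP => x xU ->; exists (cast_ord cU (enum_rank_in xU x)).
  by rewrite /l /w !ffunE cast_ordK enum_rankK_in.
pose s : {ffun 'I_p -> 'I_p} := [ffun j => xchoose (exs j)].
have es j : sigma S2 (w j) = l (s j) by rewrite [s j]ffunE; apply/eqP; apply: (xchooseP (exs j)).
have : (S1, S2, w, l, s) \in collisions.
  apply/collisionsP; split=> //.
    split=> // j j'; last first.
      move/(congr1 l); rewrite -!es => /(bs S2 S2H) h.
      by apply: iw; apply: h; apply: (subsetP US2).
    rewrite [l j]ffunE [l j']ffunE => /(bs S1 S1H) h.
    by apply: iw; apply: h; apply: (subsetP US1).
  by move=> j; split; [apply: (subsetP US1)|apply: (subsetP US2)].
move/av; rewrite inE => /negP; apply; rewrite all_cat.
apply/andP; split; apply/allP => t /mapP [j _ ->]; rewrite /holds /=.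
  by rewrite [l j]ffunE.
by rewrite es.
Qed.

End Collisions.

(** * Choice of the threshold and conclusion *)

Theorem theorem1 (p k : nat) (hp : 0 < p) (hk : 0 < k) :
  exists r0 : nat, forall r : nat, r0 <= r ->
    forall (V : finType) (H : {set {set V}}),
      uniform r H -> Delta p H <= k ->
      exists sigma : {set V} -> V -> 'I_r,
        orientation H sigma /\ p_equitable p H sigma.
Proof.
pose c := 4 * (8 * p ^ 2 * (k * p ^ p)).
(* The term [4 * p] gives [r <= 2 * (r - 2 * p)], the term [3] gives [r - 2 * p >= 3] and hence
   [Q > 2], and the last term lets the spare factor [r] absorb [c] and the loss [2 ^ (2 * p)]. *)
exists (4 * p + 3 + 2 ^ (2 * p) * c) => r ler V H unifH degH.
have r2 : r <= 2 * (r - 2 * p) by lia.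
have few : c * r ^ (2 * p).-1 <= (r - 2 * p) ^ (2 * p).
  rewrite -(@leq_pmul2l (2 ^ (2 * p))) ?expn_gt0 // -expnMn.
  apply: leq_trans (_ : r ^ (2 * p) <= _); last by rewrite leq_exp2r //; lia.
  have -> : r ^ (2 * p) = r * r ^ (2 * p).-1 by rewrite -expnS; congr (_ ^ _); lia.
  rewrite mulnA leq_mul2r; apply/orP; right; lia.
have [|||sigma bs av] := @bijections_local_lemma V r H _ (collisions r p H) _ (2 * p)
    (@collision_atoms_wf V r p H) (fun e _ => size_collision_atoms e)
    (@collision_atoms_compatible V r p H) _ _ _.
- move=> e eC; apply: leq_trans few.
  have := card_conflicting_collisions unifH degH eC; rewrite /c; nia.
- apply: leq_trans (_ : 3 ^ 1 <= _) => //.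
  apply: leq_trans (_ : 3 ^ (2 * p) <= _); first by rewrite leq_exp2l //; lia.
  by rewrite leq_exp2r; lia.
- by apply: bijections_neq0 => //; lia.
exists (fun S v => sigma S v); split; first exact: bijections_orientation.
move=> U P P' cU _ _.
have le1 Q : degP H (fun S v => sigma S v) U Q <= 1 by exact: degP_le1 bs av cU.
by move: (le1 P) (le1 P'); case: (degP _ _ _ P) => [|[]] //; case: (degP _ _ _ P') => [|[]].
Qed.
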